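(* Let $(\mathfrak g,H,\mathcal G_g)$ be a generalised pseudo-Riemannian Lie algebra, and write $\mathfrak g'=[\mathfrak g,\mathfrak g]$, $E=\mathfrak g\oplus\mathfrak g^*$. (a) Suppose $(\mathfrak g,H,\mathcal G_g,0)$ is generalised Einstein (zero divergence). Then, for $\delta\in E^*$, $(\mathfrak g,H,\mathcal G_g,\delta)$ is generalised Einstein if and only if for all $X,Y\in\mathfrak g$ $$\delta(\mathrm{ad}_X^*(X))=\delta((\mathrm{ad}_X^*(X))^\flat)=0,\quad \delta([X,Y]+H(X,Y,\cdot))=0,\quad \delta(H(X,Y,\cdot)^\sharp+[X,Y]^\flat)=0.$$ (b) Suppose $H=0$ and $(\mathfrak g,0,\mathcal G_g,\delta)$ is generalised Einstein for some $\delta\in E^*$. Then $\delta(\mathfrak g'\oplus(\mathfrak g')^\flat)=0$. In particular, if $\mathfrak g$ is perfect (e.g. semisimple), then $\delta=0$. (c) Suppose $H=0$ and $\mathrm{ad}_X^*(X)=0$ for all $X\in\mathfrak g$. Then $(\mathfrak g,0,\mathcal G_g,\delta)$ is generalised Einstein for some $\delta\in E^*$ with $\delta(\mathfrak g'\oplus(\mathfrak g')^\flat)=0$ (e.g. $\delta=0$) if and only if it is generalised Einstein for all $\delta\in E^*$ with $\delta(\mathfrak g'\oplus(\mathfrak g')^\flat)=0$. (d) Suppose $(\mathfrak g,g)$ is a quadratic Lie algebra (i.e. $g$ is $\mathrm{ad}$-invariant), and let $\delta\in E^*$. Then $(\mathfrak g,0,\mathcal G_g,\delta)$ is generalised Einstein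 if and only if $\mathrm{ad}_X$ is null (i.e. $g(\mathrm{ad}_X,\mathrm{ad}_X)=0$) for all $X\in\mathfrak g$ and $\delta(\mathfrak g'\oplus(\mathfrak g')^\flat)=0$.
   Context: Let $\mathfrak g$ be a finite-dimensional real Lie algebra. A generalised pseudo-Riemannian metric on $\mathfrak g$ is a pair $(H,\mathcal G_g)$ where $H\in\Lambda^3\mathfrak g^*$ is closed for the Chevalley–Eilenberg differential (normalised by $d\alpha(X,Y)=-\alpha([X,Y])$), $g$ is a non-degenerate symmetric bilinear form on $\mathfrak g$, and $\mathcal G_g$ is the endomorphism of $E=\mathfrak g\oplus\mathfrak g^*$ given by $\mathcal G_g(X+\xi)=\xi^\sharp+X^\flat$, with $X^\flat=g(X,\cdot)$ and $\sharp=\flat^{-1}$; then $(\mathfrak g,H,\mathcal G_g)$ is called a generalised pseudo-Riemannian Lie algebra. Let $E_\pm=\{X\pm X^\flat\mid X\in\mathfrak g\}$ be the $\pm1$-eigenspaces of $\mathcal G_g$ and $\pi_\pm=\frac12(\mathrm{id}\pm\mathcal G_g):E\to E_\pm$. The $H$-twisted Dorfman bracket on $E$ is $[X+\xi,Y+\eta]_H=[X,Y]+d\eta(X,\cdot)-d\xi(Y,\cdot)+H(X,Y,\cdot)$. A divergence operator is an element $\delta\in E^*$. For $u\in E_+$, $v\in E_-$ put $\Gamma_u=\pi_+\circ[u,\cdot]_H|_{E_-}:E_-\to E_+$ and $\Gamma_v=\pi_-\circ[v,\cdot]_H|_{E_+}:E_+\to E_-$. The generalised Ricci curvatures of $(\mathcal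 G_g,\delta)$ are, by a known result taken here as definition, $\mathcal{RC}^+(v,u)=-\mathrm{tr}(\Gamma_v\circ\Gamma_u)+\delta(\pi_+[v,u]_H)$ and $\mathcal{RC}^-(u,v)=-\mathrm{tr}(\Gamma_v\circ\Gamma_u)+\delta(\pi_-[u,v]_H)$. The quadruple $(\mathfrak g,H,\mathcal G_g,\delta)$ is generalised Einstein if $\mathcal{RC}^+=0$ and $\mathcal{RC}^-=0$ (for all $u\in E_+$, $v\in E_-$). Notation: $\mathrm{ad}_X^*$ is the $g$-adjoint of $\mathrm{ad}_X$. For endomorphisms, $g(F,G)=\sum_i\epsilon_i\,g(F(e_i),G(e_i))$ where $(e_i)$ is an orthonormal basis with $g(e_i,e_i)=\epsilon_i\in\{\pm1\}$. *)

(* Defs.v *)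
From HB Require Import structures.
From mathcomp Require Import all_boot all_order all_algebra.
From mathcomp Require Import reals.

Set Implicit Arguments.
Unset Strict Implicit.
Unset Printing Implicit Defensive.

Import Order.TTheory GRing.Theory Num.Theory.
Local Open Scope ring_scope.

(* The bracket is given by its curried form ad : V -> End(V), so that its      *)
(* bilinearity is part of its type.                                            *)
HB.mixin Record Vector_isLieAlgebra (R : fieldType) V of Vector R V := {
  ad : 'Hom(V, 'End(V));
  ad_alt : forall x : V, ad x x = 0;
  ad_jacobi : forall x y z : V,
    ad x (ad y z) + ad y (ad z x) + ad z (ad x y) = 0
}.

#[short(type="lieAlgType")]
HB.structure Definition LieAlgebra (R : fieldType) :=
  { V of Vector R V & Vector_isLieAlgebra R V }.

Notation lie x y := (ad x y).

Section LieAlgebra.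
Variables (R : fieldType) (L : lieAlgType R).

Definition lie_prodv (U V : {vspace L}) : {vspace L} :=
  <<[seq lie x y | x <- vbasis U, y <- vbasis V]>>%VS.

Definition derived : {vspace L} := lie_prodv fullv fullv.

Definition perfect : Prop := derived = fullv.

Definition lie_stable (U J : {vspace L}) : Prop :=
  forall x y, x \in U -> y \in J -> lie x y \in J.

Definition lie_ideal (J : {vspace L}) : Prop := lie_stable fullv J.

Definition simple_ideal (S : {vspace L}) : Prop :=
  [/\ lie_ideal S,
      lie_prodv S S <> 0%VS &
      forall J : {vspace L}, (J <= S)%VS -> lie_stable S J ->
        J = 0%VS \/ J = S].

(* Direct sum of simple ideals; the zero algebra is the empty sum.             *)
Definition semisimple : Prop :=
  exists (m : nat) (S : 'I_m -> {vspace L}),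
    [/\ forall i, simple_ideal (S i),
        directv (\sum_i S i)%VS &
        (\sum_i S i)%VS = fullv].

End LieAlgebra.

Arguments derived {R} L.
Arguments perfect {R} L.
Arguments semisimple {R} L.

Definition lftrace (R : fieldType) (V : vectType R) (f : 'End(V)) : R :=
  \tr (passmx.mxof (vbasis {:V}) (vbasis {:V}) f).

Notation gtangent R L := (L * 'Hom(L, R^o))%type.

Section Forms.
Variables (R : realType) (L : lieAlgType R).
Implicit Types (g : 'Hom(L, 'Hom(L, R^o))).
Implicit Types (H : 'Hom(L, 'Hom(L, 'Hom(L, R^o)))).

Definition alternating3 H : Prop :=
  forall x y : L, [/\ H x x y = 0, H x y x = 0 & H x y y = 0].

(* Chevalley-Eilenberg differentials of 1-forms and of 3-forms, normalised by  *)
(* d alpha (X, Y) = - alpha [X, Y]; d1 xi X is the 1-form (d xi)(X, -).        *)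
Definition d1 (xi : 'Hom(L, R^o)) (x : L) : 'Hom(L, R^o) := - (xi \o ad x)%VF.

Definition d3 H (x y z w : L) : R :=
  - H (lie x y) z w + H (lie x z) y w - H (lie x w) y z
  - H (lie y z) x w + H (lie y w) x z - H (lie z w) x y.

Definition closed3 H : Prop := forall x y z w, d3 H x y z w = 0.

Definition sym_form g : Prop := forall x y, g x y = g y x.

Definition nondegenerate g : Prop :=
  forall x, (forall y, g x y = 0) -> x = 0.

(* X^flat = g X is g itself as a map L -> L^*. The library inverse ^-1 is the  *)
(* genuine inverse of a bijective linear map, hence of a nondegenerate g.      *)
Definition sharp g : 'Hom('Hom(L, R^o), L) := (g^-1)%VF.

Definition gadjoint g (F : 'End(L)) (y : L) : L := sharp g (g y \o F)%VF.

Definition ad_invariant g : Prop :=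
  forall x y z, g (lie x y) z + g y (lie x z) = 0.

Definition orthonormal g n (e : n.-tuple L) : Prop :=
  (forall i j : 'I_n, i != j -> g e`_i e`_j = 0) /\
  (forall i : 'I_n, g e`_i e`_i = 1 \/ g e`_i e`_i = -1).

Definition orthonormal_basis g (e : (\dim {:L}).-tuple L) : Prop :=
  basis_of {:L} e /\ orthonormal g e.

Definition nondeg_on g (U : {vspace L}) : Prop :=
  forall x, x \in U -> (forall y, y \in U -> g x y = 0) -> x = 0.

Lemma orthonormal_basis_on g n (U : {vspace L}) :
  sym_form g -> nondeg_on g U -> \dim U = n ->
  exists e : n.-tuple L, basis_of U e /\ orthonormal g e.
Proof.
move=> gS; elim: n U => [|n IHn] U gU dU.
  exists [tuple]; split; last by split=> -[].
  by rewrite basisEdim /= dU andbT; move/eqP: dU; rewrite dimv_eq0 => /eqP->; rewrite sub0v.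
pose f x y : R := g x y.
have fS x y : f x y = f y x by exact: gS.
have fD x y z : f x (y + z) = f x y + f x z by rewrite /f linearD.
have fZ x a y : f x (a *: y) = a * f x y by rewrite /f linearZ.
have [x xU gx] : exists2 x, x \in U & f x x != 0.
  apply: boolp.contrapT => no.
  have f0 x : x \in U -> f x x = 0.
    by move=> xU; apply/eqP; apply: boolp.contrapT => /negP h; apply: no; exists x.
  suff U0 : (U <= 0)%VS.
    by move: dU; move: U0; rewrite subv0 => /eqP->; rewrite dimv0.
  apply/subvP=> x xU; rewrite memv0; apply/eqP/(gU x xU) => y yU.
  have := f0 _ (memvD xU yU).
  rewrite fD [f (x + y) x]fS [f (x + y) y]fS !fD (f0 x xU) (f0 y yU).
  rewrite add0r addr0 [f y x]fS -mulr2n => /eqP.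
  by rewrite mulrn_eq0 /= => /eqP.
pose e := (Num.sqrt `|f x x|)^-1 *: x.
have eU : e \in U by rewrite memvZ.
have ge : f e e = 1 \/ f e e = -1.
  have gx' : `|f x x| != 0 by rewrite normr_eq0.
  have -> : f e e = f x x / `|f x x|.
    by rewrite fZ fS fZ mulrA -invfM -expr2 sqr_sqrtr ?normr_ge0 // mulrC.
  have [p|p] := lerP 0 (f x x); first by rewrite ger0_norm // divff; [left|].
  by rewrite ltr0_norm // invrN mulrN divff; [right|].
have gen : f e e != 0.
  by case: ge => ->; rewrite ?oppr_eq0 oner_eq0.
pose W := (U :&: lker (g e))%VS.
have WP y : (y \in W) = (y \in U) && (f e y == 0) by rewrite memv_cap memv_ker.
have UW y : y \in U -> y - (f e y / f e e) *: e \in W.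
  move=> yU; rewrite WP memvB ?memvZ //=.
  by rewrite -scaleNr fD fZ mulNr divfK // subrr.
have gW : nondeg_on g W.
  move=> y yW0; have := yW0; rewrite WP => /andP[yU /eqP ye] h.
  apply: gU => // z zU.
  have := h _ (UW z zU); rewrite -/(f _ _) -scaleNr fD fZ.
  by rewrite [f y e]fS ye mulr0 addr0.
have eW : e \notin W by rewrite WP negb_and gen orbT.
have UeW : (<[e]> + W)%VS = U.
  apply/eqP; rewrite eqEsubv; apply/andP; split.
    by rewrite subv_add -memvE eU capvSl.
  apply/subvP=> y yU; rewrite -[y](subrK ((f e y / f e e) *: e)) addrC memv_add //.
    by rewrite memvZ // memv_line.
  exact: UW.
have e0 : e != 0 by apply: contraNneq eW => ->; rewrite mem0v.
have dW : \dim W = n.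
  have := dimv_disjoint_sum (U := <[e]>%VS) (V := W).
  rewrite UeW dU dim_vline e0 add1n => H; apply/esym/succn_inj/H.
  apply/eqP; rewrite -subv0; apply/subvP=> y; rewrite memv_cap memv0.
  case/andP=> /vlineP[k ->]; rewrite WP fZ => /andP[_].
  by rewrite mulf_eq0 (negPf gen) orbF => /eqP->; rewrite scale0r.
have [b [bW [b1 b2]]] := IHn W gW dW.
exists [tuple of e :: b]; split.
  rewrite basisEdim /= span_cons (span_basis bW) UeW subvv dU.
  by rewrite size_tuple leqnn.
have be (j : 'I_n) : f e b`_j = 0.
  have : b`_j \in W by rewrite (basis_mem bW) // mem_nth ?size_tuple.
  by rewrite WP => /andP[_ /eqP].
split=> [i j|i]; last first.
  by have [j ->|->] := unliftP ord0 i; [exact: b2|exact: ge].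
have [i' ->|->] := unliftP ord0 i; have [j' ->|->] := unliftP ord0 j => //= ij.
- by apply: b1; apply: contraNneq ij => ->.
- by rewrite gS; exact: be.
- exact: be.
Qed.

Lemma orthonormal_basis_exists g : sym_form g -> nondegenerate g ->
  exists e, orthonormal_basis g e.
Proof.
move=> gS gN; apply: orthonormal_basis_on => // x _ h; apply: gN => y.
by apply: h; rewrite memvf.
Qed.

Definition endo_form g (e : (\dim {:L}).-tuple L) (F G : 'End(L)) : R :=
  \sum_(i < \dim {:L}) (g e`_i e`_i : R) * g (F e`_i) (G e`_i).

(* The value of g(F, F) does not depend on the orthonormal basis, and such a   *)
(* basis exists (orthonormal_basis_exists).                                    *)
Definition null_endo g (F : 'End(L)) : Prop :=
  forall e, orthonormal_basis g e -> endo_form g e F F = 0.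

End Forms.

Section GeneralisedGeometry.
Variables (R : realType) (L : lieAlgType R).
Variables (H : 'Hom(L, 'Hom(L, 'Hom(L, R^o)))) (g : 'Hom(L, 'Hom(L, R^o))).

Local Notation E := (gtangent R L).

Definition gen_pseudo_riemannian : Prop :=
  [/\ alternating3 H, closed3 H, sym_form g & nondegenerate g].

Definition dorfman_fun (u v : E) : E :=
  (lie u.1 v.1, d1 v.2 u.1 - d1 u.2 v.1 + H u.1 v.1).

Fact dorfman_linear u : linear (dorfman_fun u).
Proof.
move=> a [x xi] [y eta]; rewrite /dorfman_fun /d1 /=.
rewrite !linearP /= comp_lfunDl -comp_lfunZl comp_lfunDr -comp_lfunZr.
congr pair => /=; rewrite scalerDr scalerBr scalerN.
by rewrite !opprD scalerN [RHS]addrACA; congr (_ + _); apply: addrACA.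
Qed.
HB.instance Definition _ u :=
  GRing.isLinear.Build R E E _ (dorfman_fun u) (dorfman_linear u).

Definition dorfman (u : E) : 'End(E) := linfun (dorfman_fun u).

Definition gen_metric_fun (u : E) : E := (sharp g u.2, g u.1).

Fact gen_metric_linear : linear gen_metric_fun.
Proof. by move=> a u v; rewrite /gen_metric_fun /= !linearP. Qed.
HB.instance Definition _ :=
  GRing.isLinear.Build R E E _ gen_metric_fun gen_metric_linear.

Definition gen_metric : 'End(E) := linfun gen_metric_fun.

Definition graph_plus (x : L) : E := (x, g x).
Definition graph_minus (x : L) : E := (x, - g x).

Fact graph_plus_linear : linear graph_plus.
Proof. by move=> a x y; rewrite /graph_plus linearP. Qed.
HB.instance Definition _ :=
  GRing.isLinear.Build R L E _ graph_plus graph_plus_linear.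

Fact graph_minus_linear : linear graph_minus.
Proof.
by move=> a x y; rewrite /graph_minus linearP opprD -scalerN.
Qed.
HB.instance Definition _ :=
  GRing.isLinear.Build R L E _ graph_minus graph_minus_linear.

Definition E_plus : {vspace E} := limg (linfun graph_plus).
Definition E_minus : {vspace E} := limg (linfun graph_minus).

Definition pi_plus : 'End(E) := 2^-1 *: (\1 + gen_metric)%VF.
Definition pi_minus : 'End(E) := 2^-1 *: (\1 - gen_metric)%VF.

(* vsval is the inclusion of a subspace and vsproj the corestriction to it.    *)
Definition Gamma_plus (u : E) : 'Hom(subvs_of E_minus, subvs_of E_plus) :=
  (linfun (vsproj E_plus) \o pi_plus \o dorfman u \o linfun vsval)%VF.

Definition Gamma_minus (v : E) : 'Hom(subvs_of E_plus, subvs_of E_minus) :=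
  (linfun (vsproj E_minus) \o pi_minus \o dorfman v \o linfun vsval)%VF.

Definition RC_plus (delta : 'Hom(E, R^o)) (v u : E) : R :=
  - lftrace (Gamma_minus v \o Gamma_plus u)%VF + delta (pi_plus (dorfman v u)).

Definition RC_minus (delta : 'Hom(E, R^o)) (u v : E) : R :=
  - lftrace (Gamma_minus v \o Gamma_plus u)%VF + delta (pi_minus (dorfman u v)).

Definition generalised_einstein (delta : 'Hom(E, R^o)) : Prop :=
  forall u v, u \in E_plus -> v \in E_minus ->
    RC_plus delta v u = 0 /\ RC_minus delta u v = 0.

End GeneralisedGeometry.

Definition vanishes_on_derived (R : realType) (L : lieAlgType R)
    (g : 'Hom(L, 'Hom(L, R^o))) (delta : 'Hom(gtangent R L, R^o)) : Prop :=
  forall x y, x \in derived L -> y \in derived L -> delta (x, g y) = 0.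

(* Main.v *)
From HB Require Import structures.
Require Import Defs.
From mathcomp Require Import all_boot all_order all_algebra.
From mathcomp Require Import reals lra.

(* Identify g with E_+ and E_- through X |-> X +- X^flat, and put               *)
(* S(X,Y) = ad_X^* Y + ad_Y^* X and T(X,Y) = tr(Gamma_v Gamma_u) for            *)
(* u = X + X^flat, v = Y - Y^flat. Then 2 pi_+[v,u]_H and 2 pi_-[u,v]_H are the *)
(* lifts of -([X,Y] + H(X,Y)^sharp) - S and of [X,Y] - H(X,Y)^sharp - S. If T   *)
(* is symmetric, which is the case for T = 0 and for H = 0, the part of the     *)
(* Einstein equations antisymmetric in (X,Y) says that delta vanishes on the    *)
(* lifts of [X,Y] +- H(X,Y)^sharp, and the symmetric part is delta(S) = -2T on  *)
(* both lifts. (a) is the case T = 0; (b) and (c) are the case H = 0, with      *)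
(* S = 0 in (c). In (d) again S = 0 and Gamma is half the adjoint action, so    *)
(* that T(X,Y) = tr(ad_Y ad_X) / 4 = - g(ad_Y, ad_X) / 4 by ad-invariance, and  *)
(* T = 0 is equivalent to its restriction to the diagonal by polarisation.      *)

Import Order.TTheory GRing.Theory Num.Theory.
Local Open Scope ring_scope.

(** The proof separates [delta] from the geometry. Pulled back along X |-> X +- X^flat, [delta]
    becomes a pair of linear forms [p], [m] on the Lie algebra that determine it ([lform_graphs]),
    and the Einstein condition becomes two scalar equations for each pair (X,Y), with common
    right-hand side 2T, T = [gen_trace], free of [delta] ([generalised_einsteinE]). The bracket and
    H are skew in (X,Y) while S = [ad_sym] is symmetric, so for symmetric T comparing (X,Y) with
    (Y,X) decouples the equations ([einstein_lforms]).

    Solvability with zero divergence means T = 0; recombining [p] and [m] and replacing S by its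
    diagonal 2 ad_X^* X then gives (a). For H = 0 the trace is symmetric by cyclicity and the skew
    equations say that [delta] vanishes on the derived part ([einstein0_lforms]), whence (b). If
    moreover S = 0, the rest is T = 0, a condition on g alone ([einstein0_ad_sym0]), whence (c). For
    ad-invariant g this condition is nullity of every ad_X ([null_ad_iff]), whence (d). *)

(** * Basis-free trace of endomorphisms *)

Section Trace.
Variable F : fieldType.

Lemma lftraceC (V W : vectType F) (f : 'Hom(V, W)) (h : 'Hom(W, V)) :
  lftrace (h \o f)%VF = lftrace (f \o h)%VF.
Proof.
have bV := vbasisP {:V}; have bW := vbasisP {:W}.
by rewrite /lftrace (passmx.mxof_comp _ _ bW) (passmx.mxof_comp _ _ bV) mxtrace_mulC.
Qed.

Lemma lftraceE (V : vectType F) (e : (\dim {:V}).-tuple V) (f : 'End(V)) :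
  basis_of {:V} e -> lftrace f = \sum_i coord e i (f e`_i).
Proof.
move=> be; have bV := vbasisP {:V}; rewrite /lftrace.
(* Factor f through the identity with [e] as the intermediate basis; cyclicity then moves the change
   of basis to the other side. *)
rewrite -[f in LHS]comp_lfun1l (passmx.mxof_comp _ _ be) mxtrace_mulC.
rewrite -(passmx.mxof_comp _ _ bV) comp_lfun1r.
by apply: eq_bigr => i _; rewrite !mxE /= passmx.vecof_delta.
Qed.

Lemma lftraceZ (V : vectType F) a (f : 'End(V)) : lftrace (a *: f) = a * lftrace f.
Proof.
rewrite !(lftraceE _ _ _ (vbasisP _)) mulr_sumr; apply: eq_bigr => i _.
by rewrite scale_lfunE linearZ.
Qed.

Lemma lftrace_conj (V W : vectType F) (i : 'Hom(V, W)) (j : 'Hom(W, V))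
    (f : 'End(W)) (h : 'End(V)) :
  cancel i j -> cancel j i -> (forall x, f (i x) = i (h x)) ->
  lftrace f = lftrace h.
Proof.
move=> iK jK fi; have -> : f = ((i \o h) \o j)%VF.
  by apply/lfunP => w; rewrite !comp_lfunE -fi jK.
rewrite lftraceC; congr lftrace; apply/lfunP => x.
by rewrite !comp_lfunE iK.
Qed.

Lemma lformD (V : vectType F) (phi : 'Hom(V, F^o)) x y : phi (x + y) = phi x + phi y.
Proof. exact: linearD. Qed.

Lemma lformN (V : vectType F) (phi : 'Hom(V, F^o)) x : phi (- x) = - phi x.
Proof. exact: linearN. Qed.

Lemma lformB (V : vectType F) (phi : 'Hom(V, F^o)) x y : phi (x - y) = phi x - phi y.
Proof. exact: linearB. Qed.

Lemma lformZ (V : vectType F) (phi : 'Hom(V, F^o)) a x : phi (a *: x) = a * phi x.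
Proof. exact: linearZ. Qed.

End Trace.

(** * Derived algebra; semisimple implies perfect *)

Section DerivedAlgebra.
Context {R : fieldType} {L : lieAlgType R}.

Lemma lieC (x y : L) : lie x y = - lie y x.
Proof.
have := ad_alt (x + y); rewrite !linearD /= !add_lfunE !ad_alt add0r addr0.
by move/eqP; rewrite addr_eq0 => /eqP ->; rewrite opprK.
Qed.

Lemma memv_lie (U V : {vspace L}) x y :
  x \in U -> y \in V -> lie x y \in lie_prodv U V.
Proof.
move=> xU yV; rewrite (coord_vbasis xU) (coord_vbasis yV).
rewrite linear_sum rpred_sum // => j _.
rewrite linearZ /= rpredZ // linear_sum /= sum_lfunE rpred_sum // => i _.
rewrite linearZ /= scale_lfunE rpredZ //; apply: memv_span; apply: allpairs_f.
  by rewrite mem_nth // size_tuple.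
by rewrite mem_nth // size_tuple.
Qed.

Lemma lie_prodv_sub (U V W : {vspace L}) :
  (forall x y, x \in U -> y \in V -> lie x y \in W) -> (lie_prodv U V <= W)%VS.
Proof.
move=> h; apply/span_subvP => _ /allpairsP[[x y] /= [xU yV ->]].
by apply: h; rewrite vbasis_mem.
Qed.

(** [S,S] lies in S and is S-stable, so by minimality it is 0 or S; the first is excluded, hence S =
    [S,S]. *)
Lemma simple_ideal_sub_derived (S : {vspace L}) :
  simple_ideal S -> (S <= derived L)%VS.
Proof.
case=> idS S0 minS.
have SS : (lie_prodv S S <= S)%VS.
  by apply: lie_prodv_sub => x y _; apply: idS; rewrite memvf.
have [x y xS /(subvP SS) yS||{1}<-] := minS _ SS.
- exact: memv_lie.
- by move/S0.
- by apply: lie_prodv_sub => x y _ _; rewrite memv_lie ?memvf.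
Qed.

Lemma semisimple_perfect : semisimple L -> perfect L.
Proof.
case=> m [S [simS _ sumS]]; apply/eqP; rewrite eqEsubv subvf -sumS.
by apply/subv_sumP => i _; apply: simple_ideal_sub_derived.
Qed.

End DerivedAlgebra.

(** * Musical isomorphisms and the symmetrised adjoint *)

Section Metric.
Context {R : realType} {L : lieAlgType R}.
Variable g : 'Hom(L, 'Hom(L, R^o)).
Hypothesis gN : Defs.nondegenerate g.

Lemma nondegenerate_lker0 : lker g == 0%VS.
Proof.
apply/lker0P => x y gxy; apply/eqP; rewrite -subr_eq0; apply/eqP/gN => z.
by rewrite linearB /= add_lfunE opp_lfunE gxy subrr.
Qed.

Lemma flatK : cancel g (sharp g).
Proof. exact: lker0_lfunK nondegenerate_lker0. Qed.

Lemma sharpK : cancel (sharp g) g.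
Proof.
have full : limg g = fullv.
  have lk : (fullv :&: lker g)%VS = 0%VS by rewrite (eqP nondegenerate_lker0) capv0.
  apply/eqP; rewrite eqEdim subvf /= limg_dim_eq // !dimvf /=.
  (* The dual has dimension [dim L * 1] by computation, so the injective flat map is onto. *)
  by rewrite -[X in (X <= _)%N]/(dim L * 1)%N muln1.
by move=> xi; rewrite /sharp limg_lfunVK // full memvf.
Qed.

Lemma flat_eq x y : (forall z, g x z = g y z) -> x = y.
Proof. by move=> xy; apply: (can_inj flatK); apply/lfunP. Qed.

Lemma gadjointE F y z : g (gadjoint g F y) z = g y (F z).
Proof. by rewrite /gadjoint sharpK comp_lfunE. Qed.

Definition ad_sym x y : L := gadjoint g (ad x) y + gadjoint g (ad y) x.

Lemma ad_symC x y : ad_sym x y = ad_sym y x.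
Proof. exact: addrC. Qed.

Lemma ad_sym_diag x : ad_sym x x = gadjoint g (ad x) x *+ 2.
Proof. by []. Qed.

Lemma ad_symE x y z : g (ad_sym x y) z = g y (lie x z) + g x (lie y z).
Proof. by rewrite /ad_sym linearD /= add_lfunE !gadjointE. Qed.

Lemma ad_sym_linear x : linear (ad_sym x).
Proof.
move=> a y z; apply: flat_eq => w.
rewrite linearP /= !(add_lfunE, scale_lfunE) !ad_symE !linearP /=.
rewrite !(add_lfunE, scale_lfunE) linearP /=.
by rewrite scalerDr addrACA.
Qed.
HB.instance Definition _ x :=
  GRing.isLinear.Build R L L _ (ad_sym x) (ad_sym_linear x).

(** Polarisation: [ad_sym] is symmetric and biadditive with diagonal 2 ad_X^* X, so expanding it at
    (x + y, x + y) leaves twice the mixed term. *)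
Lemma ad_sym_polar (phi : L -> R) : {morph phi : x y / x + y} ->
  (forall x, phi (gadjoint g (ad x) x) = 0) -> forall x y, phi (ad_sym x y) = 0.
Proof.
move=> phiD phi0 x y; have : phi (ad_sym (x + y) (x + y)) = 0.
  by rewrite ad_sym_diag mulr2n phiD !phi0 addr0.
rewrite [ad_sym _ _](linearD (ad_sym (x + y))) /= ![ad_sym (x + y) _]ad_symC.
rewrite [ad_sym x _](linearD (ad_sym x)) [ad_sym y _](linearD (ad_sym y)) /=.
rewrite !phiD !phi0 !(add0r, addr0) [X in _ + X = 0]addrC -mulr2n => /eqP.
by rewrite mulrn_eq0 => /eqP.
Qed.

Lemma basis_coord_orthonormal (e : (\dim {:L}).-tuple L) i x :
  orthonormal_basis g e -> coord e i x = g e`_i e`_i * g e`_i x.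
Proof.
case=> be [oe ne]; rewrite {2}(coord_basis be (memvf x)) linear_sum (bigD1 i) //=.
rewrite big1 ?addr0 => [|j ji]; last by rewrite linearZ /= oe 1?eq_sym // scaler0.
rewrite linearZ /= /GRing.scale /= mulrCA.
by case: (ne i) => ->; rewrite ?mulrNN !mulr1.
Qed.

End Metric.

(** * Projected Dorfman brackets on the two eigenbundles *)

Section GeneralisedRicci.
Context {R : realType} {L : lieAlgType R}.
Variable g : 'Hom(L, 'Hom(L, R^o)).
Hypothesis gN : Defs.nondegenerate g.
Implicit Types (H : 'Hom(L, 'Hom(L, 'Hom(L, R^o)))) (delta : 'Hom(gtangent R L, R^o)).

Lemma gen_metricE u : gen_metric g u = (sharp g u.2, g u.1).
Proof. exact: lfunE. Qed.

Lemma dorfmanE H u v :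
  dorfman H u v = (lie u.1 v.1, d1 v.2 u.1 - d1 u.2 v.1 + H u.1 v.1).
Proof. exact: lfunE. Qed.

Lemma graph_plusZ a x : graph_plus g (a *: x) = a *: graph_plus g x.
Proof. by rewrite /graph_plus [g (a *: x)]linearZ. Qed.

Lemma graph_minusZ a x : graph_minus g (a *: x) = a *: graph_minus g x.
Proof. by rewrite /graph_minus [g (a *: x)]linearZ /= -scalerN. Qed.

Lemma pi_plusE x xi : pi_plus g (x, xi) = graph_plus g (2^-1 *: (x + sharp g xi)).
Proof.
rewrite graph_plusZ /pi_plus scale_lfunE add_lfunE id_lfunE gen_metricE.
by congr (_ *: _); rewrite /graph_plus [g (x + _)]linearD /= sharpK //= [g x + _]addrC.
Qed.

Lemma pi_minusE x xi : pi_minus g (x, xi) = graph_minus g (2^-1 *: (x - sharp g xi)).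
Proof.
rewrite graph_minusZ /pi_minus scale_lfunE add_lfunE opp_lfunE id_lfunE gen_metricE.
by congr (_ *: _); rewrite /graph_minus [g (x - _)]linearB /= sharpK //= opprB.
Qed.

Lemma sharp_d1 x y : sharp g (d1 (g x) y + d1 (g y) x) = - ad_sym g x y.
Proof.
apply: (flat_eq _ gN) => z.
rewrite sharpK // [g (- _)]linearN opp_lfunE ad_symE // add_lfunE !opp_lfunE !comp_lfunE.
by rewrite opprD addrC.
Qed.

Lemma dorfman_plus_minus H x y :
  dorfman H (graph_plus g x) (graph_minus g y) =
  (lie x y, H x y - (d1 (g x) y + d1 (g y) x)).
Proof.
have dN : d1 (- g y) x = - d1 (g y) x by rewrite /d1 comp_lfunNl.
by rewrite dorfmanE /= dN -opprD addrC [d1 (g y) x + _]addrC.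
Qed.

Lemma dorfman_minus_plus H x y :
  dorfman H (graph_minus g y) (graph_plus g x) =
  (lie y x, H y x + (d1 (g x) y + d1 (g y) x)).
Proof.
have dN : d1 (- g y) x = - d1 (g y) x by rewrite /d1 comp_lfunNl.
by rewrite dorfmanE /= dN opprK addrC.
Qed.

(* Gamma_u and Gamma_v carried over to g: the former is gen_conn H x for        *)
(* u = x + x^flat, the latter gen_conn (- H) y for v = y - y^flat.              *)
Definition gen_conn_fun H x z : L := 2^-1 *: (lie x z + ad_sym g x z + sharp g (H x z)).

Fact gen_conn_linear H x : linear (gen_conn_fun H x).
Proof.
move=> a y z; rewrite /gen_conn_fun [ad_sym g x _](ad_sym_linear _ gN) !linearP /=.
rewrite scalerA mulrC -scalerA -scalerDr; congr (_ *: _).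
move: (ad_sym g x y) (ad_sym g x z) => s t.
by rewrite !scalerDr [X in X + _ = _]addrACA [LHS]addrACA.
Qed.
HB.instance Definition _ H x :=
  GRing.isLinear.Build R L L _ (gen_conn_fun H x) (gen_conn_linear H x).

Definition gen_conn H x : 'End(L) := linfun (gen_conn_fun H x).

Lemma pi_plus_plus_minus H x y :
  pi_plus g (dorfman H (graph_plus g x) (graph_minus g y)) =
  graph_plus g (gen_conn H x y).
Proof.
rewrite dorfman_plus_minus pi_plusE [gen_conn H x y]lfunE /= /gen_conn_fun.
by rewrite [sharp g (_ - _)]linearB /= sharp_d1 opprK [_ + ad_sym _ _ _]addrC addrA.
Qed.

Lemma pi_minus_minus_plus H x y :
  pi_minus g (dorfman H (graph_minus g y) (graph_plus g x)) =
  graph_minus g (gen_conn (- H) y x).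
Proof.
rewrite dorfman_minus_plus pi_minusE [gen_conn _ y x]lfunE /= /gen_conn_fun.
rewrite [sharp g (_ + _)]linearD /= sharp_d1 opprD opprK !opp_lfunE [sharp g (- _)]linearN.
by rewrite [_ + ad_sym _ _ _]addrC addrA ad_symC.
Qed.

Lemma pi_plus_minus_plus H x y :
  pi_plus g (dorfman H (graph_minus g y) (graph_plus g x)) =
  graph_plus g (2^-1 *: (lie y x + sharp g (H y x) - ad_sym g x y)).
Proof.
by rewrite dorfman_minus_plus pi_plusE [sharp g (_ + _)]linearD /= sharp_d1 addrA.
Qed.

Lemma pi_minus_plus_minus H x y :
  pi_minus g (dorfman H (graph_plus g x) (graph_minus g y)) =
  graph_minus g (2^-1 *: (lie x y - sharp g (H x y) - ad_sym g x y)).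
Proof.
rewrite dorfman_plus_minus pi_minusE [sharp g (_ - _)]linearB /= sharp_d1 opprK.
by rewrite opprD addrA.
Qed.

Lemma mem_E_plus u : reflect (exists x, u = graph_plus g x) (u \in E_plus g).
Proof.
by apply: (iffP memv_imgP) => [[x _ ->]|[x ->]]; exists x; rewrite ?memvf ?lfunE.
Qed.

Lemma mem_E_minus v : reflect (exists x, v = graph_minus g x) (v \in E_minus g).
Proof.
by apply: (iffP memv_imgP) => [[x _ ->]|[x ->]]; exists x; rewrite ?memvf ?lfunE.
Qed.

Lemma Gamma_plusE H u w :
  Gamma_plus H g u w = vsproj (E_plus g) (pi_plus g (dorfman H u (vsval w))).
Proof.
rewrite /Gamma_plus 3!comp_lfunE.
by rewrite [linfun (vsproj _) _]lfunE [linfun vsval _]lfunE.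
Qed.

Lemma Gamma_minusE H v w :
  Gamma_minus H g v w = vsproj (E_minus g) (pi_minus g (dorfman H v (vsval w))).
Proof.
rewrite /Gamma_minus 3!comp_lfunE.
by rewrite [linfun (vsproj _) _]lfunE [linfun vsval _]lfunE.
Qed.

(** * The trace term, transported to the Lie algebra *)

Definition gen_trace H x y := lftrace (gen_conn (- H) y \o gen_conn H x)%VF.

(** The graph maps identify both eigenspaces with the Lie algebra and intertwine the two Gammas with
    [gen_conn]; trace is invariant under such a conjugation. *)
Lemma trace_Gamma H x y :
  lftrace (Gamma_minus H g (graph_minus g y) \o Gamma_plus H g (graph_plus g x))%VF =
  gen_trace H x y.
Proof.
have [ip val_ip] : exists ip : 'Hom(L, subvs_of (E_plus g)),
    forall z, vsval (ip z) = graph_plus g z.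
  exists (linfun (vsproj (E_plus g)) \o linfun (graph_plus g))%VF => z.
  by rewrite comp_lfunE !lfunE /= vsprojK //; apply/mem_E_plus; exists z.
have [im val_im] : exists im : 'Hom(L, subvs_of (E_minus g)),
    forall z, vsval (im z) = graph_minus g z.
  exists (linfun (vsproj (E_minus g)) \o linfun (graph_minus g))%VF => z.
  by rewrite comp_lfunE !lfunE /= vsprojK //; apply/mem_E_minus; exists z.
(* A vector of the minus eigenspace is determined by its first component, so this projection inverts
   [im]. *)
have [jm jmE] : exists jm : 'Hom(subvs_of (E_minus g), L), forall w, jm w = (vsval w).1.
  by exists (linfun fst \o linfun vsval)%VF => w; rewrite comp_lfunE !lfunE.
have jmK z : jm (im z) = z by rewrite jmE val_im.
have imK w : im (jm w) = w.
  by apply: subvs_inj; rewrite val_im jmE; have /mem_E_minus[z ->] := subvsP w.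
have Gp z : Gamma_plus H g (graph_plus g x) (im z) = ip (gen_conn H x z).
  apply: subvs_inj; rewrite val_ip Gamma_plusE val_im pi_plus_plus_minus vsprojK //.
  by apply/mem_E_plus; exists (gen_conn H x z).
have Gm z : Gamma_minus H g (graph_minus g y) (ip z) = im (gen_conn (- H) y z).
  apply: subvs_inj; rewrite val_im Gamma_minusE val_ip pi_minus_minus_plus vsprojK //.
  by apply/mem_E_minus; exists (gen_conn (- H) y z).
apply (lftrace_conj _ _ _ im jm _ _ jmK imK) => z.
by rewrite comp_lfunE Gp Gm [in RHS]comp_lfunE.
Qed.

(** * The Einstein equations as conditions on two linear forms *)

Lemma RC_plusE H delta x y :
  RC_plus H g delta (graph_minus g y) (graph_plus g x) =
  - gen_trace H x y +
  2^-1 * delta (graph_plus g (lie y x + sharp g (H y x) - ad_sym g x y)).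
Proof.
rewrite /RC_plus trace_Gamma pi_plus_minus_plus graph_plusZ.
by congr (_ + _); exact: lformZ.
Qed.

Lemma RC_minusE H delta x y :
  RC_minus H g delta (graph_plus g x) (graph_minus g y) =
  - gen_trace H x y +
  2^-1 * delta (graph_minus g (lie x y - sharp g (H x y) - ad_sym g x y)).
Proof.
rewrite /RC_minus trace_Gamma pi_minus_plus_minus graph_minusZ.
by congr (_ + _); exact: lformZ.
Qed.

(** (x, y^flat) is half the sum of the plus lift of x + y and the minus lift of x - y. *)
Lemma lform_graphs delta :
  exists p m : 'Hom(L, R^o),
  [/\ forall x, delta (graph_plus g x) = p x, forall x, delta (graph_minus g x) = m x &
      forall x y, delta (x, g y) = 2^-1 * (p (x + y) + m (x - y))].
Proof.
pose p := (delta \o linfun (graph_plus g))%VF.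
pose m := (delta \o linfun (graph_minus g))%VF.
have pE x : delta (graph_plus g x) = p x.
  by rewrite /p comp_lfunE; congr (delta _); apply/esym; exact: lfunE.
have mE x : delta (graph_minus g x) = m x.
  by rewrite /m comp_lfunE; congr (delta _); apply/esym; exact: lfunE.
exists p, m; split=> // x y.
rewrite -pE -mE -lformD -lformZ; congr (delta _).
have half2 (V : lmodType R) (v : V) : v = 2^-1 *: (v + v).
  by rewrite -mulr2n -scaler_nat scalerA mulVf ?scale1r // pnatr_eq0.
apply: injective_projections => /=.
  by rewrite addrACA subrr addr0 -half2.
rewrite [g (x + y)]linearD [g (x - y)]linearB /= opprB.
by rewrite [g x + _]addrC addrACA subrr addr0 -half2.
Qed.

Lemma generalised_einsteinE H delta : generalised_einstein H g delta <->
  forall x y,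
  delta (graph_plus g (lie y x + sharp g (H y x) - ad_sym g x y)) = 2 * gen_trace H x y /\
  delta (graph_minus g (lie x y - sharp g (H x y) - ad_sym g x y)) = 2 * gen_trace H x y.
Proof.
have n2 : 2 != 0 :> R by rewrite pnatr_eq0.
have half (t d : R) : (- t + 2^-1 * d = 0) <-> d = 2 * t.
  split=> [/eqP|->]; last by rewrite mulKf // addNr.
  by rewrite addrC subr_eq0 => /eqP <-; rewrite mulVKf.
split=> [einst x y|einst _ _ /mem_E_plus[x ->] /mem_E_minus[y ->]].
  have up : graph_plus g x \in E_plus g by apply/mem_E_plus; exists x.
  have vm : graph_minus g y \in E_minus g by apply/mem_E_minus; exists y.
  by have [] := einst _ _ up vm; rewrite RC_plusE RC_minusE => /half-> /half->.
by have [ep em] := einst x y; rewrite RC_plusE RC_minusE; split; apply/half.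
Qed.

(** Here [a] is the skew term, [s] the symmetric one, and the two equations are those at (X,Y) and
    (Y,X). *)
Lemma antisym_sub_eq (a s u : R) : a - s = u -> - a - s = u -> a = 0 /\ s = - u.
Proof. by move=> ? ?; split; lra. Qed.

Lemma alternating3C H : alternating3 H -> forall x y, H y x = - H x y.
Proof.
move=> alt x y; apply/lfunP => z; rewrite opp_lfunE; apply/eqP; rewrite -addr_eq0.
have [hx _ _] := alt x z; have [hy _ _] := alt y z; have [h _ _] := alt (x + y) z.
move: h; rewrite linearD /= !add_lfunE !linearD /= !add_lfunE hx hy addr0 add0r addrC.
by move/eqP.
Qed.

Lemma einstein_lforms delta : exists p m : 'Hom(L, R^o),
  (forall x y, delta (x, g y) = 2^-1 * (p (x + y) + m (x - y))) /\
  forall H, alternating3 H -> (forall x y, gen_trace H x y = gen_trace H y x) ->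
  (generalised_einstein H g delta <-> forall x y,
    [/\ p (lie x y + sharp g (H x y)) = 0, m (lie x y - sharp g (H x y)) = 0,
        p (ad_sym g x y) = - (2 * gen_trace H x y) &
        m (ad_sym g x y) = - (2 * gen_trace H x y)]).
Proof.
have [p [m [pE mE deltaE]]] := lform_graphs delta.
exists p, m; split=> // H alt traceC.
have HC := alternating3C H alt.
pose A x y := lie x y + sharp g (H x y); pose B x y := lie x y - sharp g (H x y).
have AC x y : A y x = - A x y.
  by rewrite /A lieC HC [sharp g (- _)]linearN /= opprD.
have BC x y : B y x = - B x y.
  by rewrite /B lieC HC [sharp g (- _)]linearN /= -opprD.
rewrite generalised_einsteinE; split=> ein x y.
  have [] := ein y x; have [] := ein x y.
  rewrite 2!pE 2!mE -/(A x y) -/(A y x) -/(B x y) -/(B y x) (AC x y) (BC x y).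
  (* Symmetry of the trace gives both equations the same right-hand side, so they can be added and
     subtracted. *)
  rewrite [ad_sym g y x]ad_symC [gen_trace H y x]traceC.
  rewrite [p (A x y - _)]lformB [p (- A x y - _)]lformB lformN.
  rewrite [m (B x y - _)]lformB [m (- B x y - _)]lformB lformN.
  move=> pN mB pA mN; have [-> ->] := antisym_sub_eq _ _ _ pA pN.
  by have [-> ->] := antisym_sub_eq _ _ _ mB mN.
have [pA mB pS mS] := ein x y.
rewrite pE mE -/(A y x) AC [p (- A x y - _)]lformB lformN pA.
by rewrite [m (_ - ad_sym _ _ _)]lformB mB pS mS oppr0 add0r opprK.
Qed.

Lemma lform_double (phi : 'Hom(L, R^o)) x : phi (x *+ 2) = 0 -> phi x = 0.
Proof. by rewrite linearMn => /eqP; rewrite mulrn_eq0 => /eqP. Qed.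

Lemma lforms_ad_sym0 (p m : 'Hom(L, R^o)) :
  (forall x, p (gadjoint g (ad x) x) = 0 /\ m (gadjoint g (ad x) x) = 0) ->
  forall x y, p (ad_sym g x y) = 0 /\ m (ad_sym g x y) = 0.
Proof.
move=> pm0 x y; split.
  by apply: (ad_sym_polar _ gN p (lformD _ _ p)) => z; case: (pm0 z).
by apply: (ad_sym_polar _ gN m (lformD _ _ m)) => z; case: (pm0 z).
Qed.

Lemma half_add_eq0 (a b : R) :
  2^-1 * (a + b) = 0 -> 2^-1 * (a - b) = 0 -> a = 0 /\ b = 0.
Proof. by move=> ? ?; split; lra. Qed.

Lemma einstein_zero_trace H : generalised_einstein H g 0 ->
  forall x y, gen_trace H x y = 0.
Proof.
move=> /generalised_einsteinE ein x y; have [+ _] := ein x y.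
by rewrite zero_lfunE => /esym/eqP; rewrite mulf_eq0 pnatr_eq0 => /eqP.
Qed.

(** The four values of [delta] are half-sums and half-differences of values of [p] and [m]; they
    vanish in pairs exactly when those of [p] and [m] do. *)
Lemma einstein_zero_iff H delta : alternating3 H -> generalised_einstein H g 0 ->
  generalised_einstein H g delta <->
  forall x y,
    [/\ delta (gadjoint g (ad x) x, 0) = 0,
        delta (0, g (gadjoint g (ad x) x)) = 0,
        delta (lie x y, H x y) = 0 &
        delta (sharp g (H x y), g (lie x y)) = 0].
Proof.
move=> alt /einstein_zero_trace trace0.
have [p [m [deltaE einE]]] := einstein_lforms delta.
have {einE} -> : generalised_einstein H g delta <-> forall x y,
    [/\ p (lie x y + sharp g (H x y)) = 0, m (lie x y - sharp g (H x y)) = 0,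
        p (ad_sym g x y) = 0 & m (ad_sym g x y) = 0].
  rewrite (einE H alt) => [|x y]; last by rewrite !trace0.
  by split=> h x y; have := h x y; rewrite trace0 mulr0 oppr0.
have deltal z : delta (z, 0) = 2^-1 * (p z + m z).
  by have := deltaE z 0; rewrite linear0 addr0 subr0.
have deltar z : delta (0, g z) = 2^-1 * (p z - m z).
  by rewrite deltaE add0r sub0r lformN.
have deltalie x y : delta (lie x y, H x y) =
    2^-1 * (p (lie x y + sharp g (H x y)) + m (lie x y - sharp g (H x y))).
  by rewrite -deltaE sharpK.
have deltaH x y : delta (sharp g (H x y), g (lie x y)) =
    2^-1 * (p (lie x y + sharp g (H x y)) - m (lie x y - sharp g (H x y))).
  by rewrite deltaE -lformN opprB [lie x y + _]addrC.
split=> h x y.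
  have [pA mB _ _] := h x y; have [_ _] := h x x.
  rewrite ad_sym_diag => /lform_double pG /lform_double mG.
  by rewrite deltal deltar deltalie deltaH pG mG pA mB subr0 addr0 mulr0.
have [|pS mS] := lforms_ad_sym0 p m _ x y.
  by move=> z; have [] := h z z; rewrite deltal deltar => /half_add_eq0 pm /pm.
have [_ _] := h x y; rewrite deltalie deltaH => /half_add_eq0 pm /pm[-> ->].
by split.
Qed.

(** * The untwisted case H = 0 *)

Lemma alternating3_0 : alternating3 (0 : 'Hom(L, 'Hom(L, 'Hom(L, R^o)))).
Proof. by move=> x y; split; rewrite !zero_lfunE. Qed.

Lemma gen_trace0C x y : gen_trace 0 x y = gen_trace 0 y x.
Proof. by rewrite /gen_trace oppr0 lftraceC. Qed.

Lemma lform_derived0 (phi : 'Hom(L, R^o)) :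
  (forall x y, phi (lie x y) = 0) -> forall x, x \in derived L -> phi x = 0.
Proof.
move=> phi0 x xD; apply/eqP; rewrite -memv_ker; apply: subvP xD.
by apply: lie_prodv_sub => y z _ _; rewrite memv_ker phi0.
Qed.

Lemma einstein0_lforms delta : exists p m : 'Hom(L, R^o),
  generalised_einstein 0 g delta <-> vanishes_on_derived g delta /\
    forall x y, p (ad_sym g x y) = - (2 * gen_trace 0 x y) /\
                m (ad_sym g x y) = - (2 * gen_trace 0 x y).
Proof.
have [p [m [deltaE einE]]] := einstein_lforms delta; exists p, m.
have sharp0 x y : sharp g ((0 : 'Hom(L, 'Hom(L, 'Hom(L, R^o)))) x y) = 0.
  by rewrite !zero_lfunE linear0.
rewrite (einE 0 alternating3_0 gen_trace0C).
split=> [ein|[van ein] x y].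
  have lie0 x y : p (lie x y) = 0 /\ m (lie x y) = 0.
    by have [] := ein x y; rewrite sharp0 addr0 subr0.
  split=> [x y xD yD|x y]; last by have [] := ein x y.
  have pD := lform_derived0 p (fun x y => (lie0 x y).1).
  have mD := lform_derived0 m (fun x y => (lie0 x y).2).
  by rewrite deltaE (pD _ (memvD xD yD)) (mD _ (memvB xD yD)) addr0 mulr0.
have lD : lie x y \in derived L by rewrite memv_lie ?memvf.
(* Testing on ([x,y], 0) and (0, [x,y]^flat) yields the sum and the difference of [p] and [m] at
   [x,y]. *)
have := van _ _ lD (mem0v _); have := van _ _ (mem0v _) lD.
rewrite !deltaE add0r sub0r addr0 subr0 lformN => pm /half_add_eq0/(_ pm)[pl ml].
by have [] := ein x y; rewrite sharp0 addr0 subr0.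
Qed.

Lemma einstein0_vanishes delta :
  generalised_einstein 0 g delta -> vanishes_on_derived g delta.
Proof. by have [p [m einE]] := einstein0_lforms delta; case/einE. Qed.

Lemma perfect_vanishes delta : perfect L -> vanishes_on_derived g delta -> delta = 0.
Proof.
move=> perf van; apply/lfunP => -[x xi]; rewrite zero_lfunE -[xi](sharpK _ gN).
by apply: van; rewrite perf memvf.
Qed.

Lemma ad_sym0 : (forall x, gadjoint g (ad x) x = 0) ->
  forall x y, ad_sym g x y = 0.
Proof.
move=> adj0 x y; apply: (flat_eq _ gN) => z; rewrite linear0 zero_lfunE.
apply: (ad_sym_polar _ gN (fun w => g w z)) => [u v|u].
  by rewrite linearD add_lfunE.
by rewrite adj0 linear0 zero_lfunE.
Qed.

Lemma einstein0_ad_sym0 delta : (forall x, gadjoint g (ad x) x = 0) ->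
  (generalised_einstein 0 g delta <->
   vanishes_on_derived g delta /\ forall x y, gen_trace 0 x y = 0).
Proof.
move=> /ad_sym0 S0; have [p [m ->]] := einstein0_lforms delta.
have S0E (phi : 'Hom(L, R^o)) x y : phi (ad_sym g x y) = 0 by rewrite S0 linear0.
split=> -[van h]; split=> // x y; last by rewrite !S0E h mulr0 oppr0.
have [/esym/eqP + _] := h x y; rewrite S0E oppr_eq0 mulf_eq0 pnatr_eq0.
by move/eqP.
Qed.

(** * Quadratic Lie algebras *)

Section Quadratic.
Hypotheses (gS : sym_form g) (g_inv : ad_invariant g).

Lemma ad_invariant_gadjoint x : gadjoint g (ad x) x = 0.
Proof.
apply: (flat_eq _ gN) => z; rewrite gadjointE // linear0 zero_lfunE.
by have := g_inv x x z; rewrite ad_alt linear0 zero_lfunE add0r.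
Qed.

(** The coordinate along e_i is eps_i g(e_i, -), and ad-invariance moves ad_y to the other argument
    at the cost of a sign. *)
Lemma lftrace_ad_ad e x y : orthonormal_basis g e ->
  lftrace (ad y \o ad x)%VF = - endo_form g e (ad y) (ad x).
Proof.
move=> oe; rewrite (lftraceE _ _ e) ?(proj1 oe) // /endo_form -sumrN.
apply: eq_bigr => i _; rewrite (basis_coord_orthonormal _ _ _ _ oe) comp_lfunE.
by have /eqP := g_inv y e`_i (lie x e`_i); rewrite addrC addr_eq0 => /eqP ->; rewrite mulrN.
Qed.

Lemma gen_trace_ad x y : gen_trace 0 x y = 4^-1 * lftrace (ad y \o ad x)%VF.
Proof.
have S0 : forall z w, ad_sym g z w = 0 by exact: ad_sym0 ad_invariant_gadjoint.
have connE z : gen_conn 0 z = 2^-1 *: ad z.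
  apply/lfunP => w; rewrite lfunE /= /gen_conn_fun S0 !zero_lfunE linear0.
  by rewrite !addr0 scale_lfunE.
rewrite /gen_trace oppr0 !connE -comp_lfunZl -comp_lfunZr scalerA lftraceZ.
by rewrite -invfM -natrM.
Qed.

Lemma null_ad_iff : (forall x, null_endo g (ad x)) <->
  (forall x y, gen_trace 0 x y = 0).
Proof.
split=> [null x y|trace0 x e oe]; last first.
  have /eqP := trace0 x x; rewrite gen_trace_ad (lftrace_ad_ad e) //.
  by rewrite mulrN oppr_eq0 mulf_eq0 invr_eq0 pnatr_eq0 /= => /eqP.
(* A fixed orthonormal basis turns nullity into vanishing of the diagonal of a symmetric bilinear
   form [q], which polarises. *)
have [e oe] := orthonormal_basis_exists gS gN.
pose q z w := endo_form g e (ad z) (ad w).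
have qC z w : q z w = q w z.
  by apply: eq_bigr => i _; congr (_ * _); exact: gS.
have qD z w u : q (z + w) u = q z u + q w u.
  rewrite -big_split; apply: eq_bigr => i _ /=.
  by rewrite -mulrDr linearD add_lfunE linearD add_lfunE.
have q0 z : q z z = 0 by exact: null.
suff qyx : q y x = 0.
  by rewrite gen_trace_ad (lftrace_ad_ad e) // -/(q y x) qyx oppr0 mulr0.
have := q0 (y + x); rewrite qD ![q _ (y + x)]qC !qD !q0 [q x y]qC add0r addr0.
by rewrite -mulr2n => /eqP; rewrite mulrn_eq0 => /eqP.
Qed.

End Quadratic.

End GeneralisedRicci.

Theorem corollary2p19 (R : realType) (L : lieAlgType R)
    (H : 'Hom(L, 'Hom(L, 'Hom(L, R^o)))) (g : 'Hom(L, 'Hom(L, R^o)))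
    (HHg : gen_pseudo_riemannian H g) :
  (* (a) *)
  (generalised_einstein H g 0 ->
    forall delta : 'Hom(gtangent R L, R^o),
      generalised_einstein H g delta <->
      (forall X Y : L,
        [/\ delta (gadjoint g (ad X) X, 0) = 0,
            delta (0, g (gadjoint g (ad X) X)) = 0,
            delta (lie X Y, H X Y) = 0 &
            delta (sharp g (H X Y), g (lie X Y)) = 0])) /\
  (* (b) *)
  (H = 0 ->
    forall delta : 'Hom(gtangent R L, R^o),
      generalised_einstein 0 g delta ->
      vanishes_on_derived g delta /\
      (perfect L -> delta = 0) /\
      (semisimple L -> perfect L)) /\
  (* (c) *)
  (H = 0 ->
    (forall X : L, gadjoint g (ad X) X = 0) ->
    (exists2 delta : 'Hom(gtangent R L, R^o),
       vanishes_on_derived g delta & generalised_einstein 0 g delta) <->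
    (forall delta : 'Hom(gtangent R L, R^o),
       vanishes_on_derived g delta -> generalised_einstein 0 g delta)) /\
  (* (d) *)
  (ad_invariant g ->
    forall delta : 'Hom(gtangent R L, R^o),
      generalised_einstein 0 g delta <->
      (forall X : L, null_endo g (ad X)) /\ vanishes_on_derived g delta).
Proof.
case: HHg => alt _ gS gN; split; last split; last split.
- by move=> ein0 delta; apply: einstein_zero_iff.
- move=> _ delta /(einstein0_vanishes _ gN) van; split=> //.
  by split=> [perf|]; [exact: (perfect_vanishes g)|exact: semisimple_perfect].
- move=> _ adj0; split=> [[delta _ /einstein0_ad_sym0[]// _ trace0] delta' van|ein].
    by apply/einstein0_ad_sym0.
  have van0 : vanishes_on_derived g 0 by move=> x y _ _; rewrite zero_lfunE.
  by exists 0 => //; apply: ein.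
move=> ginv delta; rewrite einstein0_ad_sym0 //; last exact: ad_invariant_gadjoint.
by rewrite null_ad_iff //; split=> -[].
Qed.
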